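(* Let $u_0\in\mathrm{BUC}(\mathbb{R}^n)$ and let $f(x)=\tilde f(|x|)$ for $x\in\mathbb{R}^n$, where $\tilde f:[0,\infty)\to[0,\infty)$ is Lipschitz continuous and compactly supported. Let $u$ be the solution of $$u_t-\left(\operatorname{div}\left(\frac{Du}{|Du|}\right)+1\right)|Du|=f(x)\ \text{ in }\mathbb{R}^n\times(0,\infty),\qquad u(\cdot,0)=u_0\ \text{ on }\mathbb{R}^n,$$ and let $c_f$ be its asymptotic speed. Then $$c_f=\max_{r\in[n-1,\infty)}\tilde f(r)=\max_{|x|\ge n-1}f(x).$$
   Context: $\mathrm{BUC}(\mathbb{R}^n)$ is the set of bounded uniformly continuous functions on $\mathbb{R}^n$. The solution $u\in C(\mathbb{R}^n\times[0,\infty))$ is the viscosity solution that is bounded on $\mathbb{R}^n\times[0,T]$ for each $T>0$; the equation is $u_t+F(Du,D^2u)=f$ with $F(p,X)=-\operatorname{tr}\left(\left(I_n-\frac{p\otimes p}{|p|^2}\right)X\right)-|p|$ for $p\ne0$, and at $Du=0$ subsolutions are tested with the lower semicontinuous envelope $F_*$ and supersolutions with the upper semicontinuous envelope $F^*$. The asymptotic speed is the constant $c_f$ (independent of $u_0\in\mathrm{BUC}(\mathbb{R}^n)$) with $\lim_{t\to\infty}u(x,t)/t=c_f$ locally uniformly for $x\in\mathbb{R}^n$. *)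

(* Defs.v *)
From HB Require Import structures.
From mathcomp Require Import all_boot all_order all_algebra.
From mathcomp Require Import all_classical all_reals all_analysis.

Set Implicit Arguments.
Unset Strict Implicit.
Unset Printing Implicit Defensive.

Import Order.TTheory GRing.Theory Num.Theory.
Import numFieldNormedType.Exports.

Local Open Scope classical_set_scope.
Local Open Scope ring_scope.

(* The library norm `|x| on 'rV[R]_n is the sup norm: it gives the usual
   topology and uniformity, but |x| in the equation is the Euclidean norm. *)
Definition enorm (R : realType) (n : nat) (x : 'rV[R]_n) : R :=
  Num.sqrt (\sum_(i < n) x 0 i ^+ 2).

Definition BUC (R : realType) (n : nat) (g : 'rV[R]_n -> R) : Prop :=
  [bounded g x | x in [set: 'rV[R]_n]] /\ unif_continuous g.

(* m is the maximum (not merely the supremum) of A. *)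
Definition is_max (R : realType) (A : set R) (m : R) : Prop :=
  A m /\ ubound A m.

Section Calculus.
Variables (R : realType) (n : nat).
Implicit Types (phi : 'rV[R]_n * R -> R) (z : 'rV[R]_n * R).

Definition space_dir (i : 'I_n) : 'rV[R]_n * R := (delta_mx 0 i, 0).
Definition time_dir : 'rV[R]_n * R := (0, 1).

Definition dt phi z : R := 'D_time_dir phi z.
Definition grad phi z : 'rV[R]_n := \row_i 'D_(space_dir i) phi z.
Definition hess phi z : 'M[R]_n :=
  \matrix_(i, j) 'D_(space_dir j) ('D_(space_dir i) phi) z.

(* On an open set of a finite-dimensional space, phi is C^1 (resp. C^2) iff all
   its first (resp. first and second) directional derivatives exist and are
   continuous. *)
Definition C1_on (U : set ('rV[R]_n * R)) phi : Prop :=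
  forall v z, U z -> derivable phi z v /\ {for z, continuous ('D_v phi)}.

Definition C2_on (U : set ('rV[R]_n * R)) phi : Prop :=
  C1_on U phi /\ forall v, C1_on U ('D_v phi).

End Calculus.

Section Viscosity.
Variables (R : realType) (n : nat).

(* F(p, X) for p != 0; the value of this expression at p = 0 is never used. *)
Definition mcfF (p : 'rV[R]_n) (X : 'M[R]_n) : R :=
  - \tr ((1%:M - (enorm p ^+ 2)^-1 *: (p^T *m p)) *m X) - enorm p.

(* The domain (R^n \ {0}) x S^n of F. *)
Definition Fdom : set ('rV[R]_n * 'M[R]_n) :=
  [set q | q.1 != 0 /\ q.2^T = q.2].

Definition lsc_env (F : 'rV[R]_n -> 'M[R]_n -> R)
    (p : 'rV[R]_n) (X : 'M[R]_n) : \bar R :=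
  limf_einf (fun q : 'rV[R]_n * 'M[R]_n => (F q.1 q.2)%:E)
            (within Fdom (nbhs (p, X))).

Definition usc_env (F : 'rV[R]_n -> 'M[R]_n -> R)
    (p : 'rV[R]_n) (X : 'M[R]_n) : \bar R :=
  limf_esup (fun q : 'rV[R]_n * 'M[R]_n => (F q.1 q.2)%:E)
            (within Fdom (nbhs (p, X))).

Definition Qpos : set ('rV[R]_n * R) := [set z | 0 < z.2].

Definition visc_subsolution (F : 'rV[R]_n -> 'M[R]_n -> R) (f : 'rV[R]_n -> R)
    (u : 'rV[R]_n * R -> R) : Prop :=
  forall (phi : 'rV[R]_n * R -> R) (z0 : 'rV[R]_n * R),
    C2_on Qpos phi -> Qpos z0 ->
    (\forall z \near z0, u z - phi z <= u z0 - phi z0) ->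
    ((dt phi z0)%:E + lsc_env F (grad phi z0) (hess phi z0)
       <= (f z0.1)%:E)%E.

Definition visc_supersolution (F : 'rV[R]_n -> 'M[R]_n -> R)
    (f : 'rV[R]_n -> R) (u : 'rV[R]_n * R -> R) : Prop :=
  forall (phi : 'rV[R]_n * R -> R) (z0 : 'rV[R]_n * R),
    C2_on Qpos phi -> Qpos z0 ->
    (\forall z \near z0, u z0 - phi z0 <= u z - phi z) ->
    ((f z0.1)%:E
       <= (dt phi z0)%:E + usc_env F (grad phi z0) (hess phi z0))%E.

(* u is only relevant on R^n x [0, +oo[. *)
Definition visc_solution_ivp (F : 'rV[R]_n -> 'M[R]_n -> R)
    (f : 'rV[R]_n -> R) (u0 : 'rV[R]_n -> R) (u : 'rV[R]_n * R -> R) : Prop :=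
  [/\ {within [set z | 0 <= z.2], continuous u},
      forall T : R, 0 < T -> [bounded u z | z in [set z | 0 <= z.2 <= T]],
      visc_subsolution F f u,
      visc_supersolution F f u &
      forall x, u (x, 0) = u0 x].

(* Locally uniform convergence is uniform convergence on compact sets, R^n being
   locally compact. *)
Definition asymptotic_speed (u : 'rV[R]_n * R -> R) (c : R) : Prop :=
  {family compact, (fun t (x : 'rV[R]_n) => u (x, t) / t) @ +oo
                   --> (fun=> c : R)}.

End Viscosity.

(* Main.v *)
(* The speed is squeezed between explicit C^2 barriers m t + H(|x - y|^2), for
   which the viscosity inequalities at an interior extremum of u - phi give the
   comparison directly.  Such a function has gradient a w and Hessian
   a I + b w^T w with w = x - y, so F equals -(n - 1) a - |a| |w|: for a > 0 the
   two terms act together, while for a < 0 the sign is that of n - 1 - |w|.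
   A slope decreasing in |x| is therefore costless inside the ball of radius n - 1
   and helps supersolutions there, so that only the values of f outside this ball
   count (upper bound).  A profile peaked on the sphere of radius r > n - 1
   propagates the value of f on that sphere everywhere (lower bound); for n = 1
   the profile is peaked at a point instead.  Both profiles are so flat where
   their gradient vanishes that their Hessian vanishes too, unless x = y, which
   makes F continuous there and removes the envelopes from the discussion.
   The term in time is cubed beyond T, so that no extremum occurs at the final
   time, and only the value at time T is used. *)
Require Import Defs.
From HB Require Import structures.
From mathcomp Require Import all_boot all_order all_algebra.
From mathcomp Require Import all_classical all_reals all_analysis.
From mathcomp Require Import ring lra.

Set Implicit Arguments.
Unset Strict Implicit.
Unset Printing Implicit Defensive.

Import Order.TTheory GRing.Theory Num.Theory.
Import numFieldNormedType.Exports.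

Local Open Scope classical_set_scope.
Local Open Scope ring_scope.

(** * Directional derivatives reduced to one variable *)

Section DirectionalDerivatives.
Context {R : realType} {V : normedModType R}.

(** The two difference quotients coincide, so the one-variable rules of differentiation become
    available on [V]. *)
Lemma is_derive_lineP (f : V -> R) (z v : V) (d : R) :
  is_derive z v f d <->
  is_derive (0 : R) (1 : R) (fun h : R => f (h *: v + z)) d.
Proof.
have E : (fun h : R => h^-1 *: ((f \o shift z) (h *: v) - f z)) =
  (fun h : R => h^-1 *: (((fun h : R => f (h *: v + z)) \o shift 0) (h *: (1:R))
     - f (0 *: v + z))).
  by apply/funext => h /=; rewrite addr0 scale0r add0r [_%:A]mulr1.
by split=> -[d1 d2]; split; move: d1 d2; rewrite /derivable /derive E.
Qed.

(** Only the restriction of [g] to one line enters, so the one-variable chain rule applies. *)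
Lemma is_derive_comp (H : R -> R) (g : V -> R) (z v : V) (dH dg : R) :
  is_derive (g z) 1 H dH -> is_derive z v g dg ->
  is_derive z v (H \o g) (dH * dg).
Proof.
move=> HH /is_derive_lineP Hg; apply/is_derive_lineP.
have := @is_derive1_comp R H (fun h : R => g (h *: v + z)) 0 dH dg.
rewrite /= scale0r add0r; exact.
Qed.

End DirectionalDerivatives.

(** * Euclidean inner product and norm on row vectors *)

Section Dotp.
Context {R : realType} {n : nat}.
Implicit Types u v w x y : 'rV[R]_n.

Definition dotp u v : R := \sum_i u 0 i * v 0 i.

Lemma dotpC u v : dotp u v = dotp v u.
Proof. by apply: eq_bigr => i _; rewrite mulrC. Qed.

Lemma dotpDl u v w : dotp (u + v) w = dotp u w + dotp v w.
Proof. by rewrite -big_split; apply: eq_bigr => i _; rewrite mxE mulrDl. Qed.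

Lemma dotpZl (a : R) u w : dotp (a *: u) w = a * dotp u w.
Proof. by rewrite mulr_sumr; apply: eq_bigr => i _; rewrite mxE mulrA. Qed.

Lemma dotpDr u v w : dotp w (u + v) = dotp w u + dotp w v.
Proof. by rewrite !(dotpC w) dotpDl. Qed.

Lemma dotpZr (a : R) u w : dotp w (a *: u) = a * dotp w u.
Proof. by rewrite !(dotpC w) dotpZl. Qed.

Lemma dotpBl u v w : dotp (u - v) w = dotp u w - dotp v w.
Proof. by rewrite -scaleN1r dotpDl dotpZl mulN1r. Qed.

Lemma dot0p u : dotp 0 u = 0.
Proof. by rewrite -(scale0r u) dotpZl mul0r. Qed.

Lemma dotp_ge0 u : 0 <= dotp u u.
Proof. by apply: sumr_ge0 => i _; rewrite -expr2 sqr_ge0. Qed.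

Lemma dotp_delta u i : dotp u (delta_mx 0 i) = u 0 i.
Proof.
rewrite /dotp (bigD1 i) //= mxE !eqxx mulr1 big1 ?addr0 // => j ji.
by rewrite mxE eqxx (negbTE ji) mulr0.
Qed.

Lemma enormE u : enorm u = Num.sqrt (dotp u u).
Proof. by congr Num.sqrt; apply: eq_bigr => i _; rewrite expr2. Qed.

Lemma enorm_ge0 u : 0 <= enorm u. Proof. exact: sqrtr_ge0. Qed.

Lemma enorm_sqr u : enorm u ^+ 2 = dotp u u.
Proof. by rewrite enormE sqr_sqrtr ?dotp_ge0. Qed.

Lemma enorm_eq0 u : (enorm u == 0) = (u == 0).
Proof.
apply/idP/eqP => [|->]; last first.
  by rewrite enormE dot0p sqrtr0.
rewrite -sqrf_eq0 enorm_sqr /dotp psumr_eq0; last first.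
  by move=> i _; rewrite -expr2 sqr_ge0.
move/allP => u0; apply/rowP => i; rewrite mxE; apply/eqP.
by have := u0 i (mem_index_enum _); rewrite -expr2 sqrf_eq0.
Qed.

Lemma enormZ (a : R) u : enorm (a *: u) = `|a| * enorm u.
Proof.
rewrite !enormE dotpZl dotpC dotpZl mulrA -expr2 sqrtrM ?sqr_ge0 //.
by rewrite sqrtr_sqr.
Qed.

Lemma coord_le_enorm u i : `|u 0 i| <= enorm u.
Proof.
rewrite -sqrtr_sqr; apply: ler_wsqrtr; rewrite (bigD1 i) //= lerDl.
by apply: sumr_ge0 => j _; rewrite sqr_ge0.
Qed.

Lemma cvg_coord (T : Type) (F : set_system T) (FF : Filter F) (m k : nat)
    (f : T -> 'M[R]_(m, k)) (a : 'M[R]_(m, k)) i j :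
  f @ F --> a -> f t i j @[t --> F] --> a i j.
Proof. by move=> fa; apply: (cvg_comp f (fun M => M i j) fa); apply: coord_continuous. Qed.

Lemma cvg_dotp (T : Type) (F : set_system T) (FF : Filter F)
    (f g : T -> 'rV[R]_n) (a b : 'rV[R]_n) :
  f @ F --> a -> g @ F --> b -> dotp (f t) (g t) @[t --> F] --> dotp a b.
Proof.
move=> fa gb; apply: cvg_big => [|i _]; first exact: add_continuous.
by apply: cvgM; apply: cvg_coord.
Qed.

Lemma enorm_continuous : continuous (@enorm R n).
Proof.
move=> x; have -> : @enorm R n = Num.sqrt \o (fun u => dotp u u).
  by apply/funext => u; rewrite enormE.
apply: continuous_comp; last exact: sqrt_continuous.
apply: (@cvg_dotp _ (nbhs x) _ id id); exact: cvg_id.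
Qed.

End Dotp.

(** * Derivatives of functions radial in space plus a function of time *)

Section RadialFunctions.
Context {R : realType} {n : nat} (y : 'rV[R]_n) (H H1 H2 P P1 P2 : R -> R).
Hypothesis dH : forall s : R, is_derive s (1 : R) H (H1 s).
Hypothesis dH1 : forall s : R, is_derive s (1 : R) H1 (H2 s).
Hypothesis dP : forall s : R, is_derive s (1 : R) P (P1 s).
Hypothesis dP1 : forall s : R, is_derive s (1 : R) P1 (P2 s).
Hypothesis cH2 : continuous H2.
Hypothesis cP2 : continuous P2.

(** The variable of [H] is the squared distance, so that smoothness of [H] alone gives smoothness at
    x = y. *)
Definition radial (z : 'rV[R]_n * R) : R := H (dotp (z.1 - y) (z.1 - y)) + P z.2.

Let V : normedModType R := ('rV[R]_n * R)%type.

Lemma is_derive_dotp_fst (w : 'rV[R]_n) (z v : V) :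
  is_derive z v (fun z : V => dotp (z.1 - y) w) (dotp v.1 w).
Proof.
apply/is_derive_lineP.
have -> : (fun h : R => dotp ((h *: v + z).1 - y) w) =
    (fun h : R => dotp v.1 w * h + dotp (z.1 - y) w).
  apply/funext => h /=; rewrite -addrA dotpDl dotpZl mulrC //.
by apply: is_derive_eq; rewrite addr0 [_%:A]mulr1.
Qed.

Lemma is_derive_sqdist (z v : V) :
  is_derive z v (fun z : V => dotp (z.1 - y) (z.1 - y)) (2 * dotp (z.1 - y) v.1).
Proof.
apply/is_derive_lineP.
have -> : (fun h : R => dotp ((h *: v + z).1 - y) ((h *: v + z).1 - y)) =
   (fun h : R => dotp v.1 v.1 * (h * h) + (2 * dotp (z.1 - y) v.1) * h
      + dotp (z.1 - y) (z.1 - y)).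
  apply/funext => h /=; rewrite -addrA; move: (z.1 - y) => d.
  by rewrite !(dotpDl, dotpZl, dotpDr, dotpZr) (dotpC v.1 d); ring.
by apply: is_derive_eq; rewrite !scale0r /= !addr0 scaler0 add0r [_%:A]mulr1.
Qed.

Lemma is_derive_snd (z v : V) : is_derive z v (snd : V -> R) v.2.
Proof.
apply/is_derive_lineP => /=.
have -> : (fun h : R => (h *: v + z).2) = (fun h : R => v.2 * h + z.2).
  by apply/funext => h /=; rewrite mulrC.
by apply: is_derive_eq; rewrite addr0 [_%:A]mulr1.
Qed.

Definition Dradial (v z : V) : R :=
  H1 (dotp (z.1 - y) (z.1 - y)) * (2 * dotp (z.1 - y) v.1) + P1 z.2 * v.2.

Definition DDradial (v w z : V) : R :=
  H2 (dotp (z.1 - y) (z.1 - y)) * (2 * dotp (z.1 - y) w.1)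
    * (2 * dotp (z.1 - y) v.1)
  + H1 (dotp (z.1 - y) (z.1 - y)) * (2 * dotp w.1 v.1) + P2 z.2 * w.2 * v.2.

Lemma is_derive_radial (z v : V) : is_derive z v radial (Dradial v z).
Proof.
by apply: is_deriveD; apply: is_derive_comp => //;
  [exact: is_derive_sqdist|exact: is_derive_snd].
Qed.

Lemma is_derive_Dradial (z v w : V) : is_derive z w (Dradial v) (DDradial v w z).
Proof.
have d1 := is_derive_comp (dH1 _) (is_derive_sqdist z w).
have d2 := is_derive_comp (dP1 _) (is_derive_snd z w).
have d3 := is_derive_dotp_fst v.1 z w.
have -> : Dradial v = (H1 \o (fun z : V => dotp (z.1 - y) (z.1 - y)))
    * (2 \*: (fun z : V => dotp (z.1 - y) v.1)) + v.2 \*: (P1 \o snd).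
  by apply/funext => t; rewrite /Dradial mulrC [P1 _ * _]mulrC mulrC.
apply: is_derive_eq; rewrite /DDradial /=.
have E (a b : R) : a *: (b : R^o) = a * b by [].
by rewrite !E; ring.
Qed.

Lemma derive_radial (v : V) : 'D_v radial = Dradial v.
Proof. by apply/funext => z; have [] := is_derive_radial z v. Qed.

Lemma derive_Dradial (v w : V) : 'D_w (Dradial v) = DDradial v w.
Proof. by apply/funext => z; have [] := is_derive_Dradial z v w. Qed.

Lemma is_derive1_continuous (g g' : R -> R) :
  (forall s : R, is_derive s (1 : R) g (g' s)) -> continuous g.
Proof.
by move=> dg s; apply/differentiable_continuous/derivable1_diffP; have [] := dg s.
Qed.

Lemma continuous_dotp_fst (w : 'rV[R]_n) :
  continuous (fun z : V => dotp (z.1 - y) w).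
Proof.
move=> z; apply: (@cvg_dotp _ _ _ (nbhs z)); last exact: cvg_cst.
by apply: cvgB; [exact: cvg_fst|exact: cvg_cst].
Qed.

Lemma continuous_sqdist : continuous (fun z : V => dotp (z.1 - y) (z.1 - y)).
Proof.
by move=> z; apply: (@cvg_dotp _ _ _ (nbhs z));
  apply: cvgB; by [exact: cvg_fst|exact: cvg_cst].
Qed.

Let continuous_comp_sqdist (g : R -> R) : continuous g ->
  continuous (fun z : V => g (dotp (z.1 - y) (z.1 - y))).
Proof.
move=> cg z; apply: (@continuous_comp V R R (fun z => dotp (z.1 - y) (z.1 - y)) g).
  exact: continuous_sqdist.
exact: cg.
Qed.

Let continuous_comp_snd (g : R -> R) : continuous g ->
  continuous (fun z : V => g z.2).
Proof.
move=> cg z; apply: (@continuous_comp V R R snd g); [exact: cvg_snd|exact: cg].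
Qed.

Lemma continuous_radial : continuous radial.
Proof.
move=> z; apply: cvgD.
  by apply: continuous_comp_sqdist; exact: is_derive1_continuous dH.
by apply: continuous_comp_snd; exact: is_derive1_continuous dP.
Qed.

Lemma continuous_Dradial (v : V) : continuous (Dradial v).
Proof.
move=> z; apply: cvgD; apply: cvgM; last exact: cvg_cst.
- by apply: continuous_comp_sqdist; exact: is_derive1_continuous dH1.
- by apply: cvgM; [exact: cvg_cst|exact: continuous_dotp_fst].
- by apply: continuous_comp_snd; exact: is_derive1_continuous dP1.
Qed.

Lemma continuous_DDradial (v w : V) : continuous (DDradial v w).
Proof.
move=> z; apply: cvgD; first apply: cvgD.
- apply: cvgM; first apply: cvgM.
  + exact: continuous_comp_sqdist.
  + by apply: cvgM; [exact: cvg_cst|exact: continuous_dotp_fst].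
  + by apply: cvgM; [exact: cvg_cst|exact: continuous_dotp_fst].
- apply: cvgM; last exact: cvg_cst.
  by apply: continuous_comp_sqdist; exact: is_derive1_continuous dH1.
- apply: cvgM; last exact: cvg_cst.
  apply: cvgM; last exact: cvg_cst.
  exact: continuous_comp_snd.
Qed.

Lemma C2_radial (U : set ('rV[R]_n * R)) : C2_on U radial.
Proof.
split=> [v z _|v w z _]; rewrite derive_radial.
  split; last exact: continuous_Dradial.
  by have [] := is_derive_radial z v.
rewrite derive_Dradial; split; last exact: continuous_DDradial.
by have [] := is_derive_Dradial z v w.
Qed.

Lemma dt_radial z : dt radial z = P1 z.2.
Proof.
rewrite [LHS](@derive_val _ _ _ _ _ _ _ (is_derive_radial _ _)) /Dradial /=.
by rewrite dotpC dot0p !mulr0 add0r mulr1.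
Qed.

Lemma grad_radial z :
  grad radial z = (2 * H1 (dotp (z.1 - y) (z.1 - y))) *: (z.1 - y).
Proof.
apply/rowP => i; rewrite !mxE.
rewrite [LHS](@derive_val _ _ _ _ _ _ _ (is_derive_radial _ _)) /Dradial /=.
rewrite dotp_delta !mxE mulr0.
by rewrite addr0 mulrCA mulrA.
Qed.

Lemma hess_radial z :
  hess radial z = (2 * H1 (dotp (z.1 - y) (z.1 - y)))%:M
    + (4 * H2 (dotp (z.1 - y) (z.1 - y))) *: ((z.1 - y)^T *m (z.1 - y)).
Proof.
apply/matrixP => i j; rewrite !mxE derive_radial.
rewrite [LHS](@derive_val _ _ _ _ _ _ _ (is_derive_Dradial _ _ _)) /DDradial /=.
rewrite !dotp_delta mulr0 addr0 [RHS]addrC; congr (_ + _).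
  move: (z.1 - y) => d; rewrite big_ord1 [d^T i _]mxE (ord1 ord0); ring.
by rewrite mxE eqxx /= eq_sym; case: eqP => _; rewrite ?mulr1n ?mulr0n; ring.
Qed.

End RadialFunctions.

(** * Limits of the curvature operator and its envelopes *)

Section CurvatureOperator.
Context {R : realType} {n : nat}.
Implicit Types (p q w : 'rV[R]_n) (X Y : 'M[R]_n) (a b : R).

(** By cyclicity, the trace of p^T p X is the scalar p X p^T. *)
Lemma mcfFE p X :
  mcfF p X = - \tr X + (enorm p ^+ 2)^-1 * dotp (p *m X) p - enorm p.
Proof.
rewrite /mcfF mulmxBl mul1mx -scalemxAl raddfB /= linearZ /= -mulmxA mxtrace_mulC.
rewrite /mxtrace big_ord1 mxE opprB addrC [in RHS]addrC; congr (_ + _).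
rewrite addrC; congr (- _ + _ * _).
by apply: eq_bigr => i _; rewrite [p^T _ _]mxE.
Qed.

(** Divided by |q|^2, this bounds the singular quotient by the entries of Y, uniformly in the
    direction of q. *)
Lemma dotp_mulmx_le q Y :
  `|dotp (q *m Y) q| <= enorm q ^+ 2 * \sum_i \sum_j `|Y i j|.
Proof.
have -> : dotp (q *m Y) q = \sum_i \sum_j q 0 i * Y i j * q 0 j.
  rewrite exchange_big; apply: eq_bigr => j _.
  by rewrite mxE mulr_suml.
rewrite mulr_sumr; apply: le_trans (ler_norm_sum _ _ _) _; apply: ler_sum => i _.
rewrite mulr_sumr; apply: le_trans (ler_norm_sum _ _ _) _; apply: ler_sum => j _.
rewrite !normrM mulrAC ler_wpM2r // expr2.
by apply: ler_pM => //; exact: coord_le_enorm.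
Qed.

Lemma cvg_mulmx (T : Type) (F : set_system T) (FF : Filter F) (m k l : nat)
    (f : T -> 'M[R]_(m, k)) (g : T -> 'M[R]_(k, l))
    (A : 'M[R]_(m, k)) (B : 'M[R]_(k, l)) i j :
  f @ F --> A -> g @ F --> B -> (f t *m g t) i j @[t --> F] --> (A *m B) i j.
Proof.
move=> fA gB; rewrite mxE.
under eq_cvg do rewrite mxE.
apply: cvg_big => [|r _]; first exact: add_continuous.
by apply: cvgM; apply: cvg_coord.
Qed.

Lemma cvg_dotp_mulmx (p : 'rV[R]_n) X :
  dotp (q.1 *m q.2) q.1 @[q --> (p, X)] --> dotp (p *m X) p.
Proof.
apply: cvg_big => [|i _]; first exact: add_continuous.
apply: cvgM.
  by apply: cvg_mulmx; [exact: cvg_fst|exact: cvg_snd].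
by apply: cvg_coord; exact: cvg_fst.
Qed.

Lemma cvg_mxtrace (p : 'rV[R]_n) X : \tr q.2 @[q --> (p, X)] --> \tr X.
Proof.
apply: cvg_big => [|i _]; first exact: add_continuous.
by apply: cvg_coord; exact: cvg_snd.
Qed.

Lemma cvg_enorm_fst (p : 'rV[R]_n) X : enorm q.1 @[q --> (p, X)] --> enorm p.
Proof. by apply: continuous_cvg; [exact: enorm_continuous|exact: cvg_fst]. Qed.

Lemma mcfF_continuous p X : p != 0 -> mcfF q.1 q.2 @[q --> (p, X)] --> mcfF p X.
Proof.
move=> p0; under eq_cvg do rewrite mcfFE.
rewrite mcfFE; apply: cvgB; last exact: cvg_enorm_fst.
apply: cvgD; first by apply: cvgN; exact: cvg_mxtrace.
apply: cvgM; last exact: cvg_dotp_mulmx.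
apply: cvgV; first by rewrite expf_neq0 // enorm_eq0.
by rewrite expr2; apply: cvgM; exact: cvg_enorm_fst.
Qed.

(** At a vanishing gradient the quotient q X q^T / |q|^2 depends on the direction of q in general,
    but for X = a I it is constantly a. For X near a I the error is controlled by the entries of X -
    a I, so F tends to - n a + a. *)
Lemma mcfF_cvg0 a :
  mcfF q.1 q.2
    @[q --> within (@Fdom R n) (nbhs (0 : 'rV[R]_n, a%:M : 'M[R]_n))]
    --> - (n%:R - 1) * a.
Proof.
(* [G] dominates the distance from [mcfF] to its limit: one term each for the trace, the quotient
   and the norm. *)
pose G (q : 'rV[R]_n * 'M[R]_n) := `|\tr (q.2 - a%:M)| +
  \sum_i \sum_j `|(q.2 - a%:M) i j| + enorm q.1.
have cB : (q.2 - a%:M) @[q --> (0 : 'rV[R]_n, a%:M : 'M[R]_n)] --> (0 : 'M[R]_n).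
  rewrite -[X in _ --> X](subrr (a%:M)); apply: cvgB; [exact: cvg_snd|exact: cvg_cst].
have G0 : G q @[q --> (0 : 'rV[R]_n, a%:M : 'M[R]_n)] --> (0 : R).
  have -> : (0 : R) = `|0 : R| + \sum_(i < n) \sum_(j < n) `|0 : R| + enorm (0 : 'rV[R]_n).
    rewrite normr0 big1 => [|i _]; last by rewrite big1 // normr0.
    by rewrite !add0r; apply/esym/eqP; rewrite enorm_eq0.
  apply: cvgD; last exact: cvg_enorm_fst.
  apply: cvgD.
    apply: cvg_norm; rewrite -[X in _ --> X](mxtrace0 _ n).
    by apply: cvg_big => [|i _]; [exact: add_continuous|apply: cvg_coord cB].
  apply: cvg_big => [|i _]; first exact: add_continuous.
  apply: cvg_big => [|j _]; first exact: add_continuous.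
  apply: cvg_norm; have := cvg_coord (i := i) (j := j) _ cB; rewrite [in X in _ --> X]mxE.
  exact.
apply/cvgrPdist_lt => e e0.
have N := cvgr_lt 0 G0 e e0.
rewrite near_withinE; apply: (filterS _ (N (nbhs_filter _))) => -[q Y] /= Ge [/= q0 _].
apply: le_lt_trans Ge; rewrite /G /=.
have e2 : 0 < enorm q ^+ 2 by rewrite exprn_gt0 // lt_def enorm_eq0 q0 enorm_ge0.
(* Splitting off a I isolates a multiple of |q|^2, which gives exactly a after division; the rest is
   error. *)
have Z : dotp (q *m Y) q = a * enorm q ^+ 2 + dotp (q *m (Y - a%:M)) q.
  by rewrite mulmxBr dotpBl mul_mx_scalar dotpZl enorm_sqr; ring.
have T : \tr Y = a * n%:R + \tr (Y - a%:M).
  by rewrite raddfB /= mxtrace_scalar -[a *+ n]mulr_natr; ring.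
rewrite mcfFE Z T mulrDr mulrCA mulVf ?gt_eqF // mulr1.
have B := dotp_mulmx_le q (Y - a%:M).
move: (\tr (Y - a%:M)) (\sum_i _) B => t s B.
have {}B : `|(enorm q ^+ 2)^-1 * dotp (q *m (Y - a%:M)) q| <= s.
  by rewrite normrM gtr0_norm ?invr_gt0 // ler_pdivrMl.
set d := _^-1 * _ in B *.
have -> : - (n%:R - 1) * a - (- (a * n%:R + t) + (a + d) - enorm q) =
    t - d + enorm q by ring.
apply: le_trans (ler_normD _ _) _; rewrite (ger0_norm (enorm_ge0 q)) lerD2r.
by apply: le_trans (ler_normB _ _) _; rewrite lerD2l.
Qed.

(** If a w is nonzero, w is an eigenvector of the Hessian with eigenvalue a + b |w|^2, and the terms
    in b cancel between trace and quotient. If a w = 0, the hypothesis reduces the Hessian to a I,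
    the case of [mcfF_cvg0]. *)
Lemma mcfF_radial_cvg w a b : (a *: w = 0 -> b *: (w^T *m w) = 0) ->
  mcfF q.1 q.2 @[q --> within (@Fdom R n)
      (nbhs (a *: w, a%:M + b *: (w^T *m w)))]
    --> - (n%:R - 1) * a - `|a| * enorm w.
Proof.
move=> ab; have [p0|p0] := eqVneq (a *: w) 0.
  have e0 : enorm (0 : 'rV[R]_n) = 0 by apply/eqP; rewrite enorm_eq0.
  rewrite -enormZ (ab p0) addr0 p0 e0 subr0.
  exact: mcfF_cvg0.
apply: cvg_within_filter.
have -> : - (n%:R - 1) * a - `|a| * enorm w = mcfF (a *: w) (a%:M + b *: (w^T *m w)).
  have S0 : a * (a * dotp w w) != 0.
    by rewrite -dotpZl -dotpZr -enorm_sqr sqrf_eq0 enorm_eq0.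
  rewrite mcfFE enorm_sqr enormZ dotpZl !dotpZr.
  have -> : (a *: w) *m (a%:M + b *: (w^T *m w)) = (a * (a + b * dotp w w)) *: w.
    rewrite mulmxDr mul_mx_scalar -scalemxAr -!scalemxAl mulmxA.
    have -> : w *m w^T = (dotp w w)%:M.
      apply/matrixP => i j; rewrite !mxE !ord1 eqxx mulr1n.
      by apply: eq_bigr => k _; rewrite mxE.
    by rewrite mul_scalar_mx !scalerA -scalerDl; congr (_ *: _); ring.
  have -> : \tr (a%:M + b *: (w^T *m w)) = a * n%:R + b * dotp w w.
    rewrite raddfD /= mxtrace_scalar linearZ /= mxtrace_mulC mulr_natr.
    congr (_ + _ * _); rewrite /mxtrace big_ord1 mxE.
    by apply: eq_bigr => i _; rewrite mxE.
  rewrite dotpZl; move: S0; rewrite !mulf_eq0 !negb_or => /and3P[a0 _ w0].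
  by field; rewrite a0 w0.
exact: mcfF_continuous.
Qed.

(** The set where F exceeds c - e belongs to the filter, and the envelope is a supremum of infima
    over such sets. *)
Lemma lsc_env_ge (F : 'rV[R]_n -> 'M[R]_n -> R) p X (c : R) :
  F q.1 q.2 @[q --> within (@Fdom R n) (nbhs (p, X))] --> c ->
  (c%:E <= lsc_env F p X)%E.
Proof.
move=> Fc; rewrite /lsc_env limf_einfE; apply/lee_subgt0Pr => e e0.
have N := cvgr_gt c Fc (c - e) (ltac:(lra)).
apply: le_ereal_sup_tmp; exists (ereal_inf
  ((fun q : 'rV[R]_n * 'M[R]_n => (F q.1 q.2)%:E) @` [set q | c - e < F q.1 q.2])).
  by exists [set q | c - e < F q.1 q.2].
by apply: le_ereal_inf_tmp => _ [q /= Fq <-]; rewrite lee_fin ltW.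
Qed.

Lemma usc_env_le (F : 'rV[R]_n -> 'M[R]_n -> R) p X (c : R) :
  F q.1 q.2 @[q --> within (@Fdom R n) (nbhs (p, X))] --> c ->
  (usc_env F p X <= c%:E)%E.
Proof.
move=> Fc; rewrite /usc_env limf_esupE; apply/lee_addgt0Pr => e e0.
have N := cvgr_lt c Fc (c + e) (ltac:(lra)).
apply: ge_ereal_inf; exists (ereal_sup
  ((fun q : 'rV[R]_n * 'M[R]_n => (F q.1 q.2)%:E) @` [set q | F q.1 q.2 < c + e])).
  by exists [set q | F q.1 q.2 < c + e].
by apply: ge_ereal_sup => _ [q /= Fq <-]; rewrite lee_fin ltW.
Qed.

End CurvatureOperator.

(** * Comparison of viscosity sub- and supersolutions with radial barriers *)

Section Comparison.
Context {R : realType} {n : nat}.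
Implicit Types (x y : 'rV[R]_n) (w : 'rV[R]_n * R -> R).

(** The sign conditions confine the positive values of [w] on 0 <= t <= T to a bounded set. A
    maximum over a compact box containing it is positive, hence avoids t = 0, t = T and the region
    beyond [L], which bounds the squared distance. *)
Lemma interior_max (y : 'rV[R]_n) w (L T : R) :
  {within [set z | 0 <= z.2], continuous w} ->
  (forall x, w (x, 0) <= 0) -> (forall x, w (x, T) <= 0) ->
  (forall x (t : R), 0 <= t <= T -> L <= dotp (x - y) (x - y) -> w (x, t) <= 0) ->
  forall z0 : 'rV[R]_n * R, 0 <= z0.2 <= T -> 0 < w z0 ->
  exists z, [/\ 0 < z.2 < T, dotp (z.1 - y) (z.1 - y) < L &
    \forall z' \near z, w z' <= w z].
Proof.
move=> cw w0 wT wL z0 z0T wz0.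
have inside (z : 'rV[R]_n * R) : 0 <= z.2 <= T -> 0 < w z -> dotp (z.1 - y) (z.1 - y) < L.
  by case: z => x t /= tT wz; rewrite ltNge; apply/negP => /wL - /(_ _ tT); lra.
(* Half-width [L] + 1 suffices: |x - y|^2 < [L] forces |x - y| < [L] + 1. *)
pose K : set ('rV[R]_n * R) :=
  [set x : 'rV[R]_n | forall i, `[y 0 i - (L + 1), y 0 i + (L + 1)]%classic (x ord0 i)] `*`
  `[(0 : R), T]%classic.
have KP (z : 'rV[R]_n * R) : 0 <= z.2 <= T -> dotp (z.1 - y) (z.1 - y) < L -> K z.
  move=> zT zL; split; last by rewrite /= in_itv.
  move=> i /=; rewrite in_itv /=.
  have := coord_le_enorm (z.1 - y) i; rewrite !mxE ler_norml.
  have := enorm_sqr (z.1 - y); have := enorm_ge0 (z.1 - y).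
  move: (enorm _) => e e0 eL /andP[h1 h2].
  by apply/andP; split; nra.
have cK : compact K.
  apply: compact_setX; last exact: segment_compact.
  apply: (@rV_compact R n (fun i => `[y 0 i - (L + 1), y 0 i + (L + 1)]%classic)).
  by move=> i; exact: segment_compact.
have KZ : K `<=` [set z | 0 <= z.2] by move=> z [_ /=]; rewrite in_itv => /andP[].
have [|z Kz zmax] := compact_EVT_max _ cK (continuous_subspaceW KZ cw).
  by exists z0; apply: KP => //; exact: inside.
have wz : 0 < w z.
  by apply: (lt_le_trans wz0); apply: zmax; rewrite inE; apply: KP => //; exact: inside.
have zT : 0 <= z.2 <= T by move: Kz; rewrite inE => -[_ /=]; rewrite in_itv.
have zL := inside z zT wz.
have zT' : 0 < z.2 < T.
  case/andP: zT => z1 z2; rewrite !lt_def z1 z2 !andbT.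
  case: (z) wz => x t /= wz; apply/andP; split; apply/eqP => E.
    by have := w0 x; rewrite -E; lra.
  by have := wT x; rewrite E; lra.
exists z; split=> //; case/andP: zT' => z1 z2.
(* The strict inequalities at [z] persist nearby, so a neighbourhood of [z] lies in [K] and the
   maximum over [K] is a local one. *)
have n1 : \forall z' \near z, 0 < z'.2
  by apply: (@cvgr_gt _ _ (nbhs z) _ snd z.2) => //; exact: cvg_snd.
have n2 : \forall z' \near z, z'.2 < T
  by apply: (@cvgr_lt _ _ (nbhs z) _ snd z.2) => //; exact: cvg_snd.
have n3 : \forall z' \near z, dotp (z'.1 - y) (z'.1 - y) < L.
  by apply: (@cvgr_lt _ _ (nbhs z) _ _ (dotp (z.1 - y) (z.1 - y))) => //;
    exact: continuous_sqdist.
near=> z'; apply: zmax; rewrite inE; apply: KP.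
  by apply/andP; split; apply: ltW; near: z'.
by near: z'.
Unshelve. all: by end_near.
Qed.

Section RadialBarrier.
Variables (y : 'rV[R]_n) (H H1 H2 P P1 P2 : R -> R).
Hypothesis dH : forall s : R, is_derive s (1 : R) H (H1 s).
Hypothesis dH1 : forall s : R, is_derive s (1 : R) H1 (H2 s).
Hypothesis dP : forall s : R, is_derive s (1 : R) P (P1 s).
Hypothesis dP1 : forall s : R, is_derive s (1 : R) P1 (P2 s).
Hypothesis cH2 : continuous H2.
Hypothesis cP2 : continuous P2.
Hypothesis H12 : forall s : R, H1 s = 0 -> H2 s = 0.

(* [mcfF] at the gradient and Hessian of x |-> H (|x - y|^2); [H12] makes both
   envelopes take this value where the gradient vanishes. *)
Definition radial_mcfF (x : 'rV[R]_n) : R :=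
  - (n%:R - 1) * (2 * H1 (dotp (x - y) (x - y)))
  - `|2 * H1 (dotp (x - y) (x - y))| * enorm (x - y).

Let phi := radial y H P.

(** The gradient vanishes only if [H1] = 0, and then [H2] = 0, or if x = y; the rank-one part of the
    Hessian vanishes in both cases. *)
Lemma mcfF_radial_cvg_at (z : 'rV[R]_n * R) :
  mcfF q.1 q.2 @[q --> within (@Fdom R n) (nbhs (grad phi z, hess phi z))]
    --> radial_mcfF z.1.
Proof.
rewrite (grad_radial _ dH dP) (hess_radial _ dH dH1 dP dP1).
apply: mcfF_radial_cvg => /eqP; rewrite scaler_eq0 mulf_eq0 pnatr_eq0 /=.
case/orP=> /eqP E; last by rewrite E mulmx0 scaler0.
by rewrite H12 // mulr0 scale0r.
Qed.

Variables (f : 'rV[R]_n -> R) (u : 'rV[R]_n * R -> R) (L T : R).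
Hypothesis cu : {within [set z | 0 <= z.2], continuous u}.

(** If u exceeded the barrier somewhere, their difference would have an interior local maximum. The
    barrier is an admissible test function there, and its strict inequality contradicts that of the
    subsolution. *)
Lemma visc_subsolution_le_radial : visc_subsolution (@mcfF R n) f u ->
  (forall x, u (x, 0) <= phi (x, 0)) ->
  (forall x, u (x, T) <= phi (x, T)) ->
  (forall x (t : R), 0 <= t <= T -> L <= dotp (x - y) (x - y) -> u (x, t) <= phi (x, t)) ->
  (forall x (t : R), 0 < t < T -> dotp (x - y) (x - y) < L -> f x < P1 t + radial_mcfF x) ->
  forall x (t : R), 0 <= t <= T -> u (x, t) <= phi (x, t).
Proof.
move=> sub p0 pT pL pf x t tT; rewrite leNgt; apply/negP => ltu.
have cw : {within [set z | 0 <= z.2], continuous (u - phi)}.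
  move=> z; apply: cvgB; first exact: cu.
  by apply: continuous_subspaceT; exact: continuous_radial dH dP.
have w0 x' : (u - phi) (x', 0) <= 0 by rewrite subr_le0.
have wT x' : (u - phi) (x', T) <= 0 by rewrite subr_le0.
have wL x' (t' : R) : 0 <= t' <= T -> L <= dotp (x' - y) (x' - y) ->
    (u - phi) (x', t') <= 0 by move=> t'T x'L; rewrite subr_le0; exact: pL.
have w1 : 0 < (u - phi) (x, t) by rewrite subr_gt0.
have [[x' t'] [/= t'T x'L mx]] := interior_max cw w0 wT wL (z0 := (x, t)) tT w1.
have := sub phi (x', t') (C2_radial y dH dH1 dP dP1 cH2 cP2 _) _ mx.
rewrite /Qpos /= => /(_ (proj1 (andP t'T))); apply/negP; rewrite -ltNge.
have := lsc_env_ge (@mcfF_radial_cvg_at (x', t')).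
rewrite (dt_radial _ dH dP) /= => le; apply: lt_le_trans (leeD2l _ le).
by rewrite -EFinD lte_fin; exact: pf.
Qed.

Lemma visc_supersolution_ge_radial : visc_supersolution (@mcfF R n) f u ->
  (forall x, phi (x, 0) <= u (x, 0)) ->
  (forall x, phi (x, T) <= u (x, T)) ->
  (forall x (t : R), 0 <= t <= T -> L <= dotp (x - y) (x - y) -> phi (x, t) <= u (x, t)) ->
  (forall x (t : R), 0 < t < T -> dotp (x - y) (x - y) < L -> P1 t + radial_mcfF x < f x) ->
  forall x (t : R), 0 <= t <= T -> phi (x, t) <= u (x, t).
Proof.
move=> sup p0 pT pL pf x t tT; rewrite leNgt; apply/negP => ltu.
have cw : {within [set z | 0 <= z.2], continuous (phi - u)}.
  move=> z; apply: cvgB; last exact: cu.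
  by apply: continuous_subspaceT; exact: continuous_radial dH dP.
have w0 x' : (phi - u) (x', 0) <= 0 by rewrite subr_le0.
have wT x' : (phi - u) (x', T) <= 0 by rewrite subr_le0.
have wL x' (t' : R) : 0 <= t' <= T -> L <= dotp (x' - y) (x' - y) ->
    (phi - u) (x', t') <= 0 by move=> t'T x'L; rewrite subr_le0; exact: pL.
have w1 : 0 < (phi - u) (x, t) by rewrite subr_gt0.
have [[x' t'] [/= t'T x'L mx]] := interior_max cw w0 wT wL (z0 := (x, t)) tT w1.
(* The local maximum of [phi] - [u] is read as a local minimum of [u] - [phi], as the supersolution
   test requires. *)
have {}mx : \forall z \near (x', t'), u (x', t') - phi (x', t') <= u z - phi z.
  apply: filterS mx => z mz.
  have : phi z - u z <= phi (x', t') - u (x', t') by exact: mz.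
  lra.
have := sup phi (x', t') (C2_radial y dH dH1 dP dP1 cH2 cP2 _) _ mx.
rewrite /Qpos /= => /(_ (proj1 (andP t'T))); apply/negP; rewrite -ltNge.
have := usc_env_le (@mcfF_radial_cvg_at (x', t')).
rewrite (dt_radial _ dH dP) /= => le; apply: le_lt_trans (leeD2l _ le) _.
by rewrite -EFinD lte_fin; exact: pf.
Qed.

End RadialBarrier.
End Comparison.

(** * Powers of the positive part *)

Section Cutoff.
Context {R : realType}.
Implicit Types s t : R.

Definition pos s : R := Num.max 0 s.

Lemma pos_ge0 s : 0 <= pos s. Proof. by rewrite le_max lexx. Qed.

Lemma pos_id s : 0 <= s -> pos s = s. Proof. exact: max_r. Qed.

Lemma pos_eq0 s : s <= 0 -> pos s = 0. Proof. exact: max_l. Qed.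

Lemma pos_continuous : continuous pos.
Proof. by move=> s; apply: continuous_max; [exact: cvg_cst|exact: cvg_id]. Qed.

(** Whatever the signs of s and t, the difference quotient differs from 2 [pos] s by at most |s -
    t|, so the Carathéodory slope is continuous at s. *)
Lemma is_derive_pos_sqr s : is_derive s (1 : R) (fun t => pos t ^+ 2) (2 * pos s).
Proof.
apply/is_derive1_caratheodory.
pose g t := if t == s then 2 * pos s else (pos t ^+ 2 - pos s ^+ 2) / (t - s).
exists g; split; last by rewrite /g eqxx.
- move=> t; rewrite /g; case: eqVneq => [->|ts]; first by rewrite !subrr mulr0.
  by rewrite divfK // subr_eq0.
- have gs : g s = 2 * pos s by rewrite /g eqxx.
  suff : g t @[t --> s] --> 2 * pos s by rewrite -gs.
  apply/cvgrPdist_le => e e0.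
  have : \forall t \near s, `|s - t| < e.
    exact: (cvgr_dist_lt (F := nbhs s) id s cvg_id e e0).
  apply: filterS => t /ltW st; apply: le_trans st; rewrite /g.
  case: eqVneq => [->|ts]; first by rewrite !subrr.
  have ts0 : 0 < `|s - t| by rewrite normr_gt0 subr_eq0 eq_sym.
  (* Multiplication by |s - t| clears the quotient and leaves a quadratic inequality in each of the
     four sign cases. *)
  rewrite -(ler_pM2r ts0) -normrM -expr2 real_normK ?num_real //.
  have -> : (2 * pos s - (pos t ^+ 2 - pos s ^+ 2) / (t - s)) * (s - t) =
      2 * pos s * (s - t) + pos t ^+ 2 - pos s ^+ 2.
    by field; rewrite subr_eq0.
  case: (lerP 0 s) => s0; case: (lerP 0 t) => t0;
    rewrite ?(pos_id s0) ?(pos_id t0) ?(pos_eq0 (ltW s0)) ?(pos_eq0 (ltW t0));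
    rewrite ler_norml; apply/andP; split; nra.
Qed.

(** This is the cube of the positive part, a C^2 function; as a product it is differentiated through
    [is_derive_pos_sqr]. *)
Definition cubepos s : R := s * pos s ^+ 2.

Lemma cubepos_ge0 s : 0 <= cubepos s.
Proof.
rewrite /cubepos; case: (lerP 0 s) => s0; first by rewrite mulr_ge0 ?sqr_ge0.
by rewrite (pos_eq0 (ltW s0)) expr0n mulr0.
Qed.

Lemma is_derive_cubepos s : is_derive s (1 : R) cubepos (3 * pos s ^+ 2).
Proof.
have d := is_derive_pos_sqr s.
have -> : cubepos = id * (fun t => pos t ^+ 2) by [].
apply: is_derive_eq.
transitivity (s * (2 * pos s) + pos s ^+ 2 * 1); first by [].
case: (lerP 0 s) => s0; first by rewrite (pos_id s0); ring.
by rewrite (pos_eq0 (ltW s0)); ring.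
Qed.

End Cutoff.

(** * From linear growth bounds to the asymptotic speed; time profiles of the barriers *)

Section SpeedBounds.
Context {R : realType} {n : nat}.
Implicit Types (u : 'rV[R]_n * R -> R) (c m C : R).

Lemma asymptotic_speed_at u c (x : 'rV[R]_n) :
  asymptotic_speed u c -> u (x, t) / t @[t --> +oo] --> c.
Proof.
move=> /fam_cvgP /(_ [set x] (@compact_set1 _ x)).
by rewrite uniform_set1.
Qed.

Lemma slope_limit_le (g : R -> R) c m C : g t / t @[t --> +oo] --> c ->
  (forall t, 0 < t -> g t <= C + m * t) -> c <= m.
Proof.
move=> gc gC; rewrite leNgt; apply/negP => mc.
have e0 : 0 < (c - m) / 2 by lra.
have n1 : \forall t \near +oo, `|c - g t / t| < (c - m) / 2.
  exact: (cvgr_dist_lt _ _ gc).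
(* Beyond this threshold |C| < t (c - m) / 2, so C + m t stays below t (c + m) / 2, half-way between
   the two slopes. *)
have n2 : \forall t \near +oo, (`|C| / ((c - m) / 2) + 1 : R) < t.
  by apply: nbhs_pinfty_gt; exact: num_real.
have [t [+ Ct]] := filter_ex (filterI n1 n2).
have C0 : 0 <= `|C| / ((c - m) / 2) by rewrite divr_ge0 // ltW.
have t0 : 0 < t by lra.
have : `|C| < (c - m) / 2 * t by rewrite mulrC -ltr_pdivrMr //; lra.
have gt := gC t t0; have aC := ler_norm C => Ct'.
rewrite ltr_norml => /andP[_]; apply/negP; rewrite -leNgt.
have : g t / t <= (c + m) / 2 by rewrite ler_pdivrMr //; lra.
lra.
Qed.

Lemma asymptotic_speed_le u c m (x : 'rV[R]_n) C : asymptotic_speed u c ->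
  (forall T, 0 < T -> u (x, T) <= C + m * T) -> c <= m.
Proof. by move=> /(asymptotic_speed_at x); exact: slope_limit_le. Qed.

Lemma asymptotic_speed_ge u c m (x : 'rV[R]_n) C : asymptotic_speed u c ->
  (forall T, 0 < T -> C + m * T <= u (x, T)) -> m <= c.
Proof.
move=> /(asymptotic_speed_at x) uc uC; rewrite -lerN2.
apply: (@slope_limit_le (fun t => - u (x, t)) _ _ (- C)).
  by under eq_cvg do rewrite mulNr; exact: cvgN.
by move=> t /uC; rewrite mulNr; lra.
Qed.

(** Affine up to T. At T + 1 the last term equals B, which is taken large enough to beat u: positive
    for upper barriers, negative for lower ones. *)
Definition time_profile (C m B T t : R) : R := C + m * t + B * cubepos (t - T).

Lemma is_derive_time_profile C m B T (t : R) :
  is_derive t (1 : R) (time_profile C m B T) (m + B * (3 * pos (t - T) ^+ 2)).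
Proof.
have d := is_derive_comp (V := R) (is_derive_cubepos _) (is_derive_shift t 1 (- T)).
have -> : time_profile C m B T =
  (cst C + m \*: id) + B \*: (cubepos \o shift (- T)) by [].
apply: is_derive_eq; rewrite -[LHS]/(0 + m * 1 + B * (3 * pos (t - T) ^+ 2 * 1)).
ring.
Qed.

Lemma is_derive2_time_profile m B T (t : R) :
  is_derive t (1 : R) (fun t => m + B * (3 * pos (t - T) ^+ 2))
    (B * (6 * pos (t - T))).
Proof.
have d := is_derive_comp (V := R) (is_derive_pos_sqr _) (is_derive_shift t 1 (- T)).
have -> : (fun t => m + B * (3 * pos (t - T) ^+ 2)) =
  cst m + (B * 3) \*: ((fun t => pos t ^+ 2) \o shift (- T)).
  by apply/funext => s; rewrite mulrA.
apply: is_derive_eq; rewrite -[LHS]/(0 + (B * 3) * (2 * pos (t - T) * 1)).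
ring.
Qed.

Lemma continuous_time_profile2 B T : continuous (fun t : R => B * (6 * pos (t - T))).
Proof.
move=> t; apply: cvgM; first exact: cvg_cst.
apply: cvgM; first exact: cvg_cst.
apply: (@continuous_comp _ _ _ (fun t => t - T) pos); last exact: pos_continuous.
by apply: cvgB; [exact: cvg_id|exact: cvg_cst].
Qed.
End SpeedBounds.

(** * Upper bound for the speed *)

Section Barriers.
Context {R : realType} {n : nat}.
Implicit Types (u : 'rV[R]_n * R -> R) (f g : 'rV[R]_n -> R) (c m C : R).

Lemma bounded_norm_le (T : Type) (g : T -> R) (A : set T) :
  [bounded g x | x in A] -> exists2 C, 0 < C & forall x, A x -> `|g x| <= C.
Proof. by move=> /pinfty_ex_gt0. Qed.

Section PlateauProfile.
Variables A d rho : R.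

(** Here s = |x|^2 and [rho] is the squared critical radius. For positive [A] and [d] the slope
    vanishes only at [rho], where the second derivative vanishes too. *)
Definition plateau (s : R) : R := A * cubepos (rho - s) + d * cubepos (s - rho).
Definition plateau1 (s : R) : R :=
  3 * d * pos (s - rho) ^+ 2 - 3 * A * pos (rho - s) ^+ 2.
Definition plateau2 (s : R) : R := 6 * d * pos (s - rho) + 6 * A * pos (rho - s).

Let is_derive_subl (s : R) : is_derive s (1 : R) (fun t : R => rho - t) (- 1).
Proof. by have := is_deriveB (is_derive_cst rho s 1) (is_derive_id s 1); rewrite sub0r. Qed.

Lemma is_derive_plateau (s : R) : is_derive s (1 : R) plateau (plateau1 s).
Proof.
have d1 := is_derive_comp (V := R) (is_derive_cubepos _) (is_derive_shift s 1 (- rho)).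
have dB := is_derive_subl s.
have d2 := is_derive_comp (V := R) (is_derive_cubepos _) dB.
have -> : plateau = A \*: (cubepos \o (fun t : R => rho - t))
   + d \*: (cubepos \o shift (- rho)) by [].
apply: is_derive_eq.
transitivity (A * (3 * pos (rho - s) ^+ 2 * -1) + d * (3 * pos (s - rho) ^+ 2 * 1)).
  by [].
by rewrite /plateau1; ring.
Qed.

Lemma is_derive_plateau1 (s : R) : is_derive s (1 : R) plateau1 (plateau2 s).
Proof.
have d1 := is_derive_comp (V := R) (is_derive_pos_sqr _) (is_derive_shift s 1 (- rho)).
have dB := is_derive_subl s.
have d2 := is_derive_comp (V := R) (is_derive_pos_sqr _) dB.
have -> : plateau1 = (3 * d) \*: ((fun t => pos t ^+ 2) \o shift (- rho))
   - (3 * A) \*: ((fun t => pos t ^+ 2) \o (fun t : R => rho - t)) by [].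
apply: is_derive_eq.
transitivity ((3 * d) * (2 * pos (s - rho) * 1)
  - (3 * A) * (2 * pos (rho - s) * -1)); first by [].
by rewrite /plateau2; ring.
Qed.

Lemma continuous_plateau2 : continuous plateau2.
Proof.
move=> s; apply: cvgD; (apply: cvgM; first exact: cvg_cst).
  apply: (@continuous_comp _ _ _ (fun t => t - rho) pos); last exact: pos_continuous.
  by apply: cvgB; [exact: cvg_id|exact: cvg_cst].
apply: (@continuous_comp _ _ _ (fun t => rho - t) pos); last exact: pos_continuous.
by apply: cvgB; [exact: cvg_cst|exact: cvg_id].
Qed.

Hypotheses (A0 : 0 < A) (d0 : 0 < d).

Lemma plateau12 (s : R) : plateau1 s = 0 -> plateau2 s = 0.
Proof.
rewrite /plateau1 /plateau2; case: (lerP s rho) => sr.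
  rewrite (@pos_eq0 _ (s - rho)) ?subr_le0 // expr0n /= !mulr0 !add0r.
  move/eqP; rewrite oppr_eq0 mulf_eq0 sqrf_eq0 gt_eqF ?mulr_gt0 //=.
  by move=> /eqP ->; rewrite mulr0.
rewrite (@pos_eq0 _ (rho - s)) ?subr_le0 ?ltW // expr0n /= !mulr0 addr0 subr0.
move/eqP; rewrite mulf_eq0 sqrf_eq0 gt_eqF ?mulr_gt0 //=.
by move=> /eqP ->; rewrite mulr0.
Qed.

Lemma plateau_ge0 (s : R) : 0 <= plateau s.
Proof. by apply: addr_ge0; rewrite mulr_ge0 ?cubepos_ge0 // ltW. Qed.

End PlateauProfile.

(** With A = lip^5 / eps^4 the last term is 6 lip d (lip d / eps)^4: it dominates lip d as soon as
    lip d > eps, and 2 eps suffices before. Here d stands for the depth n - 1 - |x| inside the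
    critical ball. *)
Lemma steep_coefficient (lip eps : R) : 0 < lip -> 0 < eps ->
  exists2 A, 0 < A &
    forall d : R, 0 <= d -> lip * d < 2 * eps + 6 * A * (d ^+ 2) ^+ 2 * d.
Proof.
move=> lip0 eps0; exists (lip ^+ 5 / eps ^+ 4); first by rewrite divr_gt0 // exprn_gt0.
move=> d d0; have -> : 6 * (lip ^+ 5 / eps ^+ 4) * (d ^+ 2) ^+ 2 * d =
    6 * (lip * d * (lip * d / eps) ^+ 4) by field; rewrite gt_eqF.
have ld : 0 <= lip * d by rewrite mulr_ge0 // ltW.
case: (lerP (lip * d) eps) => de.
  have : 0 <= lip * d * (lip * d / eps) ^+ 4.
    by rewrite mulr_ge0 // exprn_ge0 // divr_ge0 // ltW.
  by lra.
suff : lip * d <= lip * d * (lip * d / eps) ^+ 4 by lra.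
by rewrite ler_peMr // exprn_ege1 // ler_pdivlMr // mul1r ltW.
Qed.

(* The first summand of [plateau] makes the barrier steep inside the critical
   ball, where curvature turns the slope into growth; the second one, of slope
   tending to 0 as L grows, puts the barrier above u on the sphere of radius L. *)
Lemma speed_upper_bound g f u c m lip eps :
  BUC g -> visc_solution_ivp (@mcfF R n) f g u -> asymptotic_speed u c ->
  (0 < n)%N -> 0 <= m -> 0 < lip -> 0 < eps ->
  (forall x, f x <= m + lip * pos (n%:R - 1 - enorm x)) ->
  c <= m + 2 * eps.
Proof.
move=> [/bounded_norm_le[C0 C00 gC] _] [cu bu sub _ ui] uc n0 m0 lip0 eps0 fm.
pose r0 : R := n%:R - 1.
have r00 : 0 <= r0 by rewrite subr_ge0 ler1n.
have [A A0 steep] := steep_coefficient lip0 eps0.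
have A00 := ltW A0.
(* The constant is the value of the barrier at the origin at time 0; it must not depend on [T],
   whereas [C], [L] and [d] below may. *)
apply: (@asymptotic_speed_le _ _ _ _ _ 0 (C0 + A * cubepos (r0 ^+ 2)) uc) => T T0.
have T10 : 0 < T + 1 by lra.
have [C C1 uC] := bounded_norm_le (bu _ T10).
(* Once [d] makes the outer summand equal to [C] at radius [L], the size of F there is 6 C / (L -
   r0); this [L] keeps it below [eps]. *)
have [L L0 Leps] : exists2 L, r0 < L & 6 * C < eps * (L - r0).
  have Ce : 0 < C / eps by rewrite divr_gt0.
  exists (r0 + 6 * (C / eps) + 1); first by lra.
  have -> : eps * (r0 + 6 * (C / eps) + 1 - r0) = 6 * C + eps by field; rewrite gt_eqF.
  lra.
have Lr : 0 < L ^+ 2 - r0 ^+ 2 by rewrite subr_gt0 ltr_pXn2r ?nnegrE //; lra.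
have [d d0 dC] : exists2 d, 0 < d & d * (L ^+ 2 - r0 ^+ 2) ^+ 3 = C.
  exists (C / (L ^+ 2 - r0 ^+ 2) ^+ 3); first by rewrite divr_gt0 // exprn_gt0.
  by rewrite divfK // expf_neq0 // gt_eqF.
pose H := plateau A d (r0 ^+ 2).
pose P := time_profile C0 (m + 2 * eps) C T.
have Pge t : 0 <= t -> C0 + (m + 2 * eps) * t <= P t.
  by move=> t0; rewrite /P /time_profile lerDl mulr_ge0 ?cubepos_ge0 // ltW.
have me t : 0 <= t -> 0 <= (m + 2 * eps) * t by move=> t0; apply: mulr_ge0 => //; lra.
have Pge0 t : 0 <= t -> 0 <= P t.
  by move=> t0; apply: le_trans (Pge t t0); have := me t t0; lra.
have uCle x (t : R) : 0 <= t <= T + 1 -> u (x, t) <= C.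
  by move=> tT; apply: le_trans (ler_norm _) _; exact: uC.
have Hge0 s : 0 <= H s by exact: plateau_ge0.
have := @visc_subsolution_le_radial R n 0 H _ _ P _ _
  (is_derive_plateau A d (r0 ^+ 2)) (is_derive_plateau1 A d (r0 ^+ 2))
  (is_derive_time_profile _ _ _ _) (is_derive2_time_profile _ _ _)
  (continuous_plateau2 (A := A) (d := d) (rho := r0 ^+ 2))
  (continuous_time_profile2 (B := C) (T := T)) (plateau12 A0 d0)
  f u (L ^+ 2) (T + 1) cu sub.
have bt x : u (x, 0) <= radial 0 H P (x, 0).
  rewrite ui /radial /=; have := Hge0 (dotp (x - 0) (x - 0)).
  have := Pge 0 (lexx 0); have := gC x I; have := ler_norm (g x).
  by rewrite mulr0; lra.
have bT x : u (x, T + 1) <= radial 0 H P (x, T + 1).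
  rewrite /radial /=; have := Hge0 (dotp (x - 0) (x - 0)).
  have := me (T + 1) (ltW T10).
  have : u (x, T + 1) <= C by apply: uCle; lra.
  have TT : T + 1 - T = 1 by ring.
  rewrite /P /time_profile /cubepos TT pos_id // expr1n.
  lra.
have bL x (t : R) : 0 <= t <= T + 1 -> L ^+ 2 <= dotp (x - 0) (x - 0) ->
    u (x, t) <= radial 0 H P (x, t).
  move=> tT xL; rewrite /radial /=; have := uCle x t tT.
  have := Pge0 t (proj1 (andP tT)).
  suff : C <= H (dotp (x - 0) (x - 0)) by lra.
  move: (dotp _ _) xL => s sL; rewrite /H /plateau.
  apply: ler_wpDl; first by rewrite mulr_ge0 ?cubepos_ge0 // ltW.
  have sr : L ^+ 2 - r0 ^+ 2 <= s - r0 ^+ 2 by lra.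
  rewrite /cubepos pos_id; last by lra.
  rewrite -exprS -[X in X <= _]dC ler_pM2l //.
  by rewrite ler_pXn2r ?nnegrE //; lra.
move=> /(_ bt bT bL) cmp.
have {cmp}cmp := cmp _ 0 T _; rewrite /radial /= in cmp.
apply: le_trans (cmp _ _) _; last first.
- rewrite subr0 /H /plateau dot0p subr0 sub0r.
  rewrite /P /time_profile /cubepos subrr (@pos_eq0 _ (- r0 ^+ 2)) ?oppr_le0 ?sqr_ge0 //.
  by rewrite expr0n /= !mulr0 !mul0r; lra.
- by lra.
move=> x t tT; rewrite subr0 => xL; rewrite /radial_mcfF subr0 -/r0.
have xE := enorm_sqr x; have x0 := enorm_ge0 x.
have fx := fm x; rewrite -/r0 in fx.
have Pt : m + 2 * eps <= m + 2 * eps + C * (3 * pos (t - T) ^+ 2).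
  by rewrite lerDl mulr_ge0 ?(ltW C1) // mulr_ge0 ?sqr_ge0.
rewrite -xE in xL *; move: (enorm x) x0 fx xL {xE} => r x0 fx xL.
apply: le_lt_trans fx _; apply: (lt_le_trans _ (lerD Pt (lexx _))).
(* Inside the critical ball F equals 6 A (r0^2 - r^2)^2 (r0 - r), and r0^2 - r^2 >= (r0 - r)^2, so
   [steep] absorbs the Lipschitz excess of f. *)
case: (lerP r r0) => rr.
  have rs : r ^+ 2 <= r0 ^+ 2 by rewrite ler_pXn2r ?nnegrE.
  rewrite /plateau1 (@pos_eq0 _ (r ^+ 2 - _)) ?subr_le0 // !pos_id ?subr_ge0 //.
  rewrite expr0n /= mulr0 sub0r.
  have := steep _ (ltac:(lra) : 0 <= r0 - r).
  have : ((r0 - r) ^+ 2) ^+ 2 <= (r0 ^+ 2 - r ^+ 2) ^+ 2.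
    by rewrite ler_pXn2r ?nnegrE ?sqr_ge0 ?subr_ge0 //; nra.
  rewrite ler0_norm; last by rewrite mulrN oppr_le0 mulr_ge0 // mulr_ge0 ?sqr_ge0 // mulr_ge0.
  move: (((r0 - r) ^+ 2) ^+ 2) ((r0 ^+ 2 - r ^+ 2) ^+ 2) => a b ab st.
  have : 6 * A * a * (r0 - r) <= 6 * A * b * (r0 - r).
    by rewrite ler_wpM2r ?subr_ge0 // ler_wpM2l // mulr_ge0 // ltW.
  lra.
(* Outside, F equals - 6 d (r^2 - r0^2)^2 (r0 + r), whose size increases with r and is therefore
   bounded by its value at [L]. *)
have rs : r0 ^+ 2 < r ^+ 2 by rewrite ltr_pXn2r ?nnegrE.
rewrite (@pos_eq0 _ (r0 - r)) ?subr_le0 ?(ltW rr) // mulr0 addr0.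
rewrite /plateau1 (@pos_eq0 _ (r0 ^+ 2 - _)) ?subr_le0 ?(ltW rs) //.
rewrite pos_id ?subr_ge0 ?(ltW rs) // expr0n /= mulr0 subr0.
rewrite ger0_norm; last by rewrite mulr_ge0 // mulr_ge0 ?sqr_ge0 // mulr_ge0 // ltW.
have rL : r < L by rewrite -(ltr_pXn2r (n := 2)) ?nnegrE //; lra.
suff : d * (r ^+ 2 - r0 ^+ 2) ^+ 2 * (r0 + r) * 6 < eps * 2 by lra.
apply: le_lt_trans (_ : d * (L ^+ 2 - r0 ^+ 2) ^+ 2 * (r0 + L) * 6 < _).
  rewrite ler_pM2r //; apply: ler_pM; rewrite ?mulr_ge0 ?sqr_ge0 ?(ltW d0) //; try lra.
  by rewrite ler_pM2l // ler_pXn2r ?nnegrE //; lra.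
have E : d * (L ^+ 2 - r0 ^+ 2) ^+ 2 * (r0 + L) * 6 * (L - r0) = 6 * C.
  by rewrite -dC; ring.
rewrite -(ltr_pM2r (_ : 0 < L - r0)) ?subr_gt0 // E.
have : 0 < eps * (L - r0) by rewrite mulr_gt0 // subr_gt0.
lra.
Qed.

End Barriers.

(** * Lower bound for the speed *)

Section LowerBarrier.
Context {R : realType} {n : nat}.
Implicit Types (u : 'rV[R]_n * R -> R) (f g : 'rV[R]_n -> R) (c m C : R).

Section QuarticProfile.
Variables K sigma : R.

(** For positive [K] the peak is at s = [sigma], a squared radius. The fourth power makes the second
    derivative vanish at the only zero of the first. *)
Definition quartic (s : R) : R := - K * (s - sigma) ^+ 4.
Definition quartic1 (s : R) : R := - (4 * K) * (s - sigma) ^+ 3.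
Definition quartic2 (s : R) : R := - (12 * K) * (s - sigma) ^+ 2.

Let is_derive_shiftX (a s : R) k : is_derive s (1 : R)
  (fun s : R => a * (s - sigma) ^+ k.+1) (a * (k.+1%:R * (s - sigma) ^+ k)).
Proof.
have d := is_derive_shift s (1 : R) (- sigma).
have -> : (fun s : R => a * (s - sigma) ^+ k.+1) = a \*: (shift (- sigma) ^+ k.+1).
  by apply/funext => t; rewrite /= -[(_ ^+ _) t]/((shift (- sigma) ^+ k.+1) t) exprfctE.
by apply: is_derive_eq; rewrite [_ *: 1]mulr1.
Qed.

Lemma is_derive_quartic (s : R) : is_derive s (1 : R) quartic (quartic1 s).
Proof. by apply: (is_derive_eq (is_derive_shiftX _ _ 3)); rewrite /quartic1; ring. Qed.

Lemma is_derive_quartic1 (s : R) : is_derive s (1 : R) quartic1 (quartic2 s).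
Proof. by apply: (is_derive_eq (is_derive_shiftX _ _ 2)); rewrite /quartic2; ring. Qed.

Lemma continuous_quartic2 : continuous quartic2.
Proof. exact: is_derive1_continuous (is_derive_shiftX _ ^~ 1%N). Qed.

Lemma quartic12 (s : R) : 0 < K -> quartic1 s = 0 -> quartic2 s = 0.
Proof.
move=> K0 /eqP; rewrite /quartic1 /quartic2 mulf_eq0 oppr_eq0 gt_eqF ?mulr_gt0 //=.
by rewrite expf_eq0 /= => /eqP ->; rewrite expr0n mulr0.
Qed.

End QuarticProfile.

(** The barrier starts below - [C0], hence below the initial data, and tends to minus infinity in
    space, so it lies below u far from [y]. Its value at [y] at time 0 is the constant of the growth
    bound, independent of [T]. *)
Lemma speed_lower_bound g f u c m K sigma (y : 'rV[R]_n) :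
  BUC g -> visc_solution_ivp (@mcfF R n) f g u -> asymptotic_speed u c ->
  0 < K -> (forall x, m + radial_mcfF y (quartic1 K sigma) x < f x) -> m <= c.
Proof.
move=> [/bounded_norm_le[C0 C00 gC] _] [cu bu _ sup ui] uc K0 mf.
apply: (@asymptotic_speed_ge _ _ _ _ _ y (quartic K sigma 0 - C0) uc) => T T0.
have T10 : 0 < T + 1 by lra.
have [C C1 uC] := bounded_norm_le (bu _ T10).
(* Lowering the affine part of the barrier by [D] brings it below - [C], hence below u, at every
   time up to [T] + 1. *)
pose D := C + `|m| * (T + 1).
have m0 := normr_ge0 m.
have D0 : 0 < D by rewrite ltr_wpDr // mulr_ge0 // ltW.
(* For s >= [L] one has s - sigma >= 1 + D / K; as this is at least 1, its fourth power is at least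
   D / K. *)
pose L := sigma + 1 + D / K.
pose H := quartic K sigma.
pose P := time_profile (- C0) m (- D) T.
have mle t : 0 <= t <= T + 1 -> m * t <= `|m| * (T + 1).
  move=> /andP[t0 tT]; apply: le_trans (ler_norm _) _.
  by rewrite normrM (ger0_norm t0) ler_wpM2l.
have Ple t : 0 <= t -> P t <= - C0 + m * t.
  by move=> t0; rewrite /P /time_profile mulNr gerBl mulr_ge0 ?cubepos_ge0 // ltW.
have uCge x (t : R) : 0 <= t <= T + 1 -> - C <= u (x, t).
  by move=> tT; have := uC (x, t) tT; rewrite ler_norml => /andP[].
have Hle0 s : H s <= 0.
  by rewrite /H /quartic mulNr oppr_le0 mulr_ge0 ?(ltW K0) // exprn_even_ge0.
have := @visc_supersolution_ge_radial R n y H _ _ P _ _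
  (is_derive_quartic K sigma) (is_derive_quartic1 K sigma)
  (is_derive_time_profile _ _ _ _) (is_derive2_time_profile _ _ _)
  (continuous_quartic2 (K := K) (sigma := sigma))
  (continuous_time_profile2 (B := - D) (T := T)) (fun s => quartic12 K0)
  f u L (T + 1) cu sup.
have bt x : radial y H P (x, 0) <= u (x, 0).
  rewrite ui /radial /=; have := Hle0 (dotp (x - y) (x - y)).
  have := Ple 0 (lexx 0); have := gC x I; rewrite ler_norml => /andP[+ _].
  by rewrite mulr0; lra.
have bT x : radial y H P (x, T + 1) <= u (x, T + 1).
  rewrite /radial /=; have := Hle0 (dotp (x - y) (x - y)).
  have TT : 0 <= T + 1 <= T + 1 by lra.
  have := mle _ TT; have := uCge x _ TT.
  have T1 : T + 1 - T = 1 by ring.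
  rewrite /P /time_profile /cubepos T1 pos_id // expr1n /D.
  by lra.
have bL x (t : R) : 0 <= t <= T + 1 -> L <= dotp (x - y) (x - y) ->
    radial y H P (x, t) <= u (x, t).
  move=> tT xL; rewrite /radial /=; have := uCge x t tT; have := mle t tT.
  have := Ple t (proj1 (andP tT)).
  suff : H (dotp (x - y) (x - y)) <= - D by rewrite /D; lra.
  move: (dotp _ _) xL => s sL; rewrite /H /quartic mulNr lerN2.
  have DK : 0 < D / K by rewrite divr_gt0.
  have s1 : 1 + D / K <= s - sigma by move: sL; rewrite /L; lra.
  have s4 : D / K <= (s - sigma) ^+ 4.
    apply: (@le_trans _ _ (s - sigma)); first by lra.
    by apply: ler_eXnr => //; lra.
  by rewrite mulrC -ler_pdivrMr.
move=> /(_ bt bT bL) cmp.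
have {cmp}cmp := cmp _ y T _; rewrite /radial /= in cmp.
apply: le_trans (cmp _ _).
- rewrite subrr dot0p.
  by rewrite /P /time_profile /cubepos subrr mul0r mulr0 /H; lra.
- move=> x t tT xL; apply: le_lt_trans (mf x).
  by rewrite lerD2r gerDl mulNr oppr_le0 mulr_ge0 ?(ltW D0) // mulr_ge0 ?sqr_ge0.
- by lra.
Qed.

End LowerBarrier.

(** * The radial forcing term and the choice of the quartic profile *)

Section RadialForcing.
Context {R : realType} (ftilde : R -> R) (lip : R).
Hypothesis ft_ge0 : forall r : R, 0 <= r -> 0 <= ftilde r.
Hypothesis lip0 : 0 < lip.
Hypothesis ft_lip : forall r s : R, 0 <= r -> 0 <= s ->
  `|ftilde r - ftilde s| <= lip * `|r - s|.

(** Composition with [pos] extends [ftilde] continuously from the half-line to the whole line, as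
    the extreme value theorem is applied to it. *)
Lemma continuous_ftilde_pos : continuous (ftilde \o pos).
Proof.
move=> s; apply/cvgrPdist_lt => e e0.
have el : 0 < e / lip by rewrite divr_gt0.
have : \forall t \near s, `|s - t| < e / lip.
  exact: (cvgr_dist_lt (F := nbhs s) id s cvg_id _ el).
apply: filterS => t st; apply: le_lt_trans (ft_lip (pos_ge0 _) (pos_ge0 _)) _.
rewrite mulrC -ltr_pdivlMr //; apply: le_lt_trans st.
case: (lerP 0 s) => s0; case: (lerP 0 t) => t0;
  rewrite ?(pos_id s0) ?(pos_id t0) ?(pos_eq0 (ltW s0)) ?(pos_eq0 (ltW t0)) //.
- by rewrite subr0 !ger0_norm; lra.
- by rewrite sub0r normrN ger0_norm // ler0_norm; lra.
- by rewrite subr0 normr0.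
Qed.

(** Beyond the support [ftilde] is 0, and it is nonnegative elsewhere, so a maximum over a bounded
    interval is global on the half-line. *)
Lemma ftilde_max (r0 : R) : 0 <= r0 ->
  compact (closure [set r : R | 0 <= r /\ ftilde r != 0]) ->
  exists2 rm, r0 <= rm & forall r, r0 <= r -> ftilde r <= ftilde rm.
Proof.
move=> r00 /compact_bounded /bounded_norm_le[B B0 suppB].
have fB r : 0 <= r -> B < r -> ftilde r = 0.
  move=> r0' Br; apply/eqP; apply: contraTT Br => fr; rewrite -leNgt.
  by apply: le_trans (ler_norm _) (suppB _ _); apply: subset_closure.
(* The endpoint [r0] + [B] keeps the interval nonempty even if the support ends before [r0]. *)
have r0B : r0 <= r0 + B by rewrite lerDl ltW.
have [rm] := EVT_max r0B (continuous_subspaceT continuous_ftilde_pos).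
rewrite in_itv /= => /andP[rm0 rmB] mx; exists rm => // r rr.
have pr : 0 <= r by lra.
have prm : 0 <= rm by lra.
case: (lerP r (r0 + B)) => rB; last by rewrite fB ?ft_ge0 //; lra.
by have := mx r; rewrite in_itv /= rr rB => /(_ isT); rewrite !pos_id.
Qed.

(** Values inside the ball of radius [r0] may exceed [m], but only by a Lipschitz excess counted
    from the sphere; this is the form that [speed_upper_bound] takes. *)
Lemma ftilde_le_pos (r0 m r : R) : 0 <= r0 ->
  (forall s, r0 <= s -> ftilde s <= m) -> 0 <= r ->
  ftilde r <= m + lip * pos (r0 - r).
Proof.
move=> r00 fm r1; case: (lerP r0 r) => rr.
  by rewrite pos_eq0 ?subr_le0 // mulr0 addr0 fm.
rewrite pos_id; last by lra.
have := ft_lip r1 r00; have := fm r0 (lexx _); rewrite ler_norml => fr0 /andP[_].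
by rewrite distrC ger0_norm; lra.
Qed.

(** In dimension one there is no curvature, and a profile peaked at two symmetric points would gain
    nothing at the origin. With a single peak, F is - 8 K w^7 at distance w from it: near the peak f
    is close to its value there, and farther away F is at most - [M]. *)
Lemma quartic_barrier_dim1 (rm eps : R) : 0 <= rm -> 0 < eps ->
  exists2 K, 0 < K & forall x : 'rV[R]_1,
    ftilde rm - 3 * eps + radial_mcfF (const_mx rm) (quartic1 K 0) x
      < ftilde (enorm x).
Proof.
move=> rm0 eps0; set M := ftilde rm; have M0 : 0 <= M by exact: ft_ge0.
have [eta eta0 etaE] : exists2 eta, 0 < eta & lip * eta = eps.
  by exists (eps / lip); [rewrite divr_gt0|rewrite mulrC divfK // gt_eqF].
(* This gives 8 K eta^7 >= [M]; the added 1 keeps the coefficient positive when [M] = 0. *)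
exists (M / (8 * eta ^+ 7) + 1).
  by rewrite ltr_wpDl // divr_ge0 // mulr_ge0 // exprn_ge0 // ltW.
set K := _ + 1.
have K0 : 0 < K by rewrite ltr_wpDl // divr_ge0 // mulr_ge0 // exprn_ge0 // ltW.
have KM : M <= 8 * K * eta ^+ 7.
  have -> : 8 * K * eta ^+ 7 = M + 8 * eta ^+ 7 by rewrite /K; field; rewrite gt_eqF.
  by rewrite lerDl mulr_ge0 // exprn_ge0 // ltW.
move: K K0 KM => K K0 KM x.
have e1 (z : 'rV[R]_1) : enorm z = `|z 0 0| by rewrite /enorm big_ord1 sqrtr_sqr.
have xd : `|enorm x - rm| <= enorm (x - const_mx rm).
  rewrite !e1 !mxE -{1}(ger0_norm rm0); exact: ler_dist_dist.
rewrite /radial_mcfF subrr mulNr mul0r oppr0 sub0r -enorm_sqr /quartic1 subr0.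
have w0 := enorm_ge0 (x - const_mx rm); move: (enorm (x - _)) w0 xd => w w0 xd.
have x0 := enorm_ge0 x; move: (enorm x) x0 xd {e1} => r r0 xd.
have -> : `|2 * (- (4 * K) * (w ^+ 2) ^+ 3)| * w = 8 * K * w ^+ 7.
  have -> : 2 * (- (4 * K) * (w ^+ 2) ^+ 3) = - (8 * K * w ^+ 6) by ring.
  rewrite normrN ger0_norm; first by ring.
  by rewrite mulr_ge0 ?exprn_ge0 // mulr_ge0 // ltW.
case: (lerP w eta) => wE.
  have : 0 <= 8 * K * w ^+ 7 by rewrite mulr_ge0 ?exprn_ge0 // mulr_ge0 // ltW.
  have := ft_lip r0 rm0; rewrite ler_norml -/M => /andP[h _].
  have : lip * `|r - rm| <= eps by rewrite -etaE ler_pM2l // (le_trans xd).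
  lra.
have : 8 * K * eta ^+ 7 <= 8 * K * w ^+ 7.
  by rewrite ler_pM2l ?mulr_gt0 // ler_pXn2r ?nnegrE // ltW.
have := ft_ge0 r0; lra.
Qed.

(** The peak is moved to radius [rm] + [eta], strictly outside the critical sphere even if [rm] = n
    - 1, so that the slope beyond the peak keeps a definite effect. Near the peak f loses at most 2
    [eps]; away from it F is at most - [M] while f is nonnegative. *)
Lemma quartic_barrier (n : nat) (rm eps : R) : n%:R - 1 <= rm -> (1 < n)%N -> 0 < eps ->
  exists K sigma, 0 < K /\ forall x : 'rV[R]_n,
    ftilde rm - 3 * eps + radial_mcfF 0 (quartic1 K sigma) x < ftilde (enorm x).
Proof.
move=> rm0 n1 eps0; set M := ftilde rm.
set r0 : R := n%:R - 1 in rm0 *.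
have r01 : 1 <= r0.
  by rewrite /r0 lerBrDr -(natrD _ 1 1) ler_nat.
have M0 : 0 <= M by apply: ft_ge0; lra.
have [eta eta0 etaE] : exists2 eta, 0 < eta & lip * eta = eps.
  by exists (eps / lip); [rewrite divr_gt0|rewrite mulrC divfK // gt_eqF].
pose r1 := rm + eta.
have fr1 : M - eps <= ftilde r1.
  have := @ft_lip r1 rm (ltac:(rewrite /r1; lra)) (ltac:(lra)).
  have -> : r1 - rm = eta by rewrite /r1; ring.
  by rewrite (gtr0_norm eta0) etaE ler_norml => /andP[]; rewrite -/M; lra.
have e3 : 0 < eta ^+ 3 by rewrite exprn_gt0.
have e4 : 0 < eta ^+ 4 by rewrite exprn_gt0.
(* The first bound serves inside the peak sphere, where the slope is multiplied by r0 + r >= 1, the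
   second outside, where the factor r - r0 is only known to be at least [eta]. *)
have [K [K0 KM3 KM4]] : exists K,
    [/\ 0 < K, M <= 8 * K * eta ^+ 3 & M <= 8 * K * eta ^+ 3 * eta].
  exists (M / (8 * eta ^+ 3) + M / (8 * eta ^+ 4) + 1).
  have h3 : 0 <= M / (8 * eta ^+ 3) by rewrite divr_ge0 // mulr_ge0 // ltW.
  have h4 : 0 <= M / (8 * eta ^+ 4) by rewrite divr_ge0 // mulr_ge0 // ltW.
  split; first by lra.
    apply: (@le_trans _ _ (8 * (M / (8 * eta ^+ 3)) * eta ^+ 3)).
      by rewrite le_eqVlt; apply/orP; left; apply/eqP; field; rewrite gt_eqF.
    by rewrite ler_pM2r // ler_pM2l //; lra.
  apply: (@le_trans _ _ (8 * (M / (8 * eta ^+ 4)) * eta ^+ 3 * eta)).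
    by rewrite le_eqVlt; apply/orP; left; apply/eqP; field; rewrite gt_eqF.
  by rewrite ler_pM2r // ler_pM2r // ler_pM2l //; lra.
exists K, (r1 ^+ 2); split=> // x.
rewrite /radial_mcfF subr0 -/r0 -enorm_sqr /quartic1.
have x0 := enorm_ge0 x; move: (enorm x) x0 => r x0.
have r10 : 0 <= r1 by rewrite /r1; lra.
(* Since r + r1 >= 1, closeness of the squares implies closeness of the radii. *)
have close : `|r ^+ 2 - r1 ^+ 2| <= eta -> M - 2 * eps <= ftilde r.
  move=> h; have : lip * `|r - r1| <= eps.
    rewrite -etaE ler_pM2l //; apply: le_trans h.
    rewrite subr_sqr normrM ler_peMr //.
    by rewrite ger0_norm /r1; lra.
  have := ft_lip x0 r10; rewrite ler_norml => /andP[h1 _] h2; lra.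
have f0 := ft_ge0 x0.
(* Outside the peak sphere the curvature opposes the eikonal term, leaving the factor r - r0;
   inside, the two add up to r0 + r. *)
case: (lerP (r1 ^+ 2) (r ^+ 2)) => rr.
  have r1r : r1 <= r by rewrite -(ler_pXn2r (n := 2)) ?nnegrE.
  have : 0 <= r ^+ 2 - r1 ^+ 2 by rewrite subr_ge0.
  move: (r ^+ 2 - r1 ^+ 2) close => t close t0.
  have T0 : 0 <= 8 * K * t ^+ 3 by rewrite mulr_ge0 ?exprn_ge0 // mulr_ge0 // ltW.
  have -> : 2 * (- (4 * K) * t ^+ 3) = - (8 * K * t ^+ 3) by ring.
  rewrite normrN ger0_norm //.
  have -> : - r0 * - (8 * K * t ^+ 3) - 8 * K * t ^+ 3 * r =
    - (8 * K * t ^+ 3 * (r - r0)) by ring.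
  have rr0 : eta <= r - r0 by move: r1r; rewrite /r1; lra.
  case: (lerP t eta) => te.
    have := close; rewrite ger0_norm // => /(_ te).
    have : 0 <= 8 * K * t ^+ 3 * (r - r0) by rewrite mulr_ge0 //; lra.
    lra.
  have : 8 * K * eta ^+ 3 * eta <= 8 * K * t ^+ 3 * (r - r0).
    apply: ler_pM => //; rewrite ?mulr_ge0 ?(ltW eta0) ?(ltW e3) ?(ltW K0) //.
    by rewrite ler_pM2l ?mulr_gt0 // ler_pXn2r ?nnegrE // ltW.
  lra.
have : 0 < r1 ^+ 2 - r ^+ 2 by rewrite subr_gt0.
rewrite -[r ^+ 2 - _]opprB normrN in close *.
move: (r1 ^+ 2 - r ^+ 2) close => t close t0.
have T0 : 0 <= 8 * K * t ^+ 3.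
  by rewrite mulr_ge0 ?exprn_ge0 ?(ltW t0) // mulr_ge0 // ltW.
have -> : 2 * (- (4 * K) * (- t) ^+ 3) = 8 * K * t ^+ 3 by ring.
rewrite ger0_norm //.
have -> : - r0 * (8 * K * t ^+ 3) - 8 * K * t ^+ 3 * r =
    - (8 * K * t ^+ 3 * (r0 + r)) by ring.
have : 8 * K * t ^+ 3 <= 8 * K * t ^+ 3 * (r0 + r) by rewrite ler_peMr //; lra.
case: (lerP t eta) => te.
  by have := close; rewrite gtr0_norm // => /(_ te); lra.
have : 8 * K * eta ^+ 3 <= 8 * K * t ^+ 3.
  by rewrite ler_pM2l ?mulr_gt0 // ler_pXn2r ?nnegrE // ltW.
lra.
Qed.

End RadialForcing.

(** * Identification of the speed with the maximum outside the critical ball *)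

Theorem theorem5p3 (R : realType) (n : nat) (hn : (0 < n)%N)
  (u0 : 'rV[R]_n -> R) (hu0 : BUC u0)
  (ftilde : R -> R)
  (hf_ge0 : forall r : R, 0 <= r -> 0 <= ftilde r)
  (hf_lip : [lipschitz ftilde r | r in [set r : R | 0 <= r]])
  (hf_supp : compact (closure [set r : R | 0 <= r /\ ftilde r != 0]))
  (f : 'rV[R]_n -> R) (hf : forall x : 'rV[R]_n, f x = ftilde (enorm x))
  (u : 'rV[R]_n * R -> R) (hu : visc_solution_ivp (@mcfF R n) f u0 u)
  (cf : R) (hcf : asymptotic_speed u cf) :
  is_max [set ftilde r | r in [set r : R | n%:R - 1 <= r]] cf /\
  is_max [set f x | x in [set x : 'rV[R]_n | n%:R - 1 <= enorm x]] cf.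
Proof.
have [lip lip0 Lip] : exists2 lip, 0 < lip & forall r s : R, 0 <= r -> 0 <= s ->
    `|ftilde r - ftilde s| <= lip * `|r - s|.
  have [lip lip0 h] := pinfty_ex_gt0 hf_lip.
  by exists lip => // r s r0 s0; exact: (h (r, s)).
have r00 : 0 <= n%:R - 1 :> R by rewrite subr_ge0 ler1n.
have [rm rm0 rmax] := ftilde_max hf_ge0 lip0 Lip r00 hf_supp.
have prm : 0 <= rm by lra.
have upper : cf <= ftilde rm.
  apply/ler_addgt0Pr => e e0.
  have e2 : 0 < e / 2 by lra.
  have fm x : f x <= ftilde rm + lip * pos (n%:R - 1 - enorm x).
    by rewrite hf; apply: ftilde_le_pos => //; exact: enorm_ge0.
  have := speed_upper_bound hu0 hu hcf hn (hf_ge0 _ prm) lip0 e2 fm; lra.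
have lower : ftilde rm <= cf.
  apply/ler_addgt0Pr => e e0.
  have e3 : 0 < e / 3 by lra.
  (* The quartic barriers lose three times their parameter. *)
  suff : ftilde rm - 3 * (e / 3) <= cf by lra.
  have [n1|n1] := ltnP 1 n.
    have [K [sigma [K0 h]]] := quartic_barrier hf_ge0 lip0 Lip rm0 n1 e3.
    apply: (speed_lower_bound (y := 0) hu0 hu hcf K0) => x.
    by rewrite hf; exact: h.
  have n_eq : n = 1%N by apply/eqP; rewrite eqn_leq n1 hn.
  (* The data are generalised first because their types depend on [n]. *)
  move: f u0 hu0 hf u hu hcf; rewrite n_eq => f1 g1 hg1 hf1 u1 hu1 hcf1.
  have [K K0 h] := quartic_barrier_dim1 hf_ge0 lip0 Lip prm e3.
  apply: (speed_lower_bound (y := const_mx rm) hg1 hu1 hcf1 K0) => x.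
  by rewrite hf1; exact: h.
have cE : cf = ftilde rm by apply/eqP; rewrite eq_le upper lower.
rewrite cE; split; split.
- by exists rm.
- by move=> _ [r /= rr <-]; exact: rmax.
(* A multiple of the first unit vector is a point of Euclidean norm [rm], where f attains the
   maximum. *)
- exists (rm *: delta_mx 0 (Ordinal hn)).
    rewrite /= enormZ ger0_norm //.
    have -> : enorm (delta_mx 0 (Ordinal hn) : 'rV[R]_n) = 1.
      by rewrite enormE dotp_delta mxE !eqxx sqrtr1.
    by rewrite mulr1.
  rewrite hf enormZ ger0_norm //.
  have -> : enorm (delta_mx 0 (Ordinal hn) : 'rV[R]_n) = 1.
    by rewrite enormE dotp_delta mxE !eqxx sqrtr1.
  by rewrite mulr1.
- by move=> _ [x /= xr <-]; rewrite hf; exact: rmax.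
Qed.
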